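(* Assume that $\bar s\neq 0$, $\mathrm{val}\,\mathrm{P}(\bar s)\in\mathbb{R}$, $\nu$ is lower semi-continuous at $\bar s$ and $\mathrm{Sol}\,\mathrm{D}(\bar s)\neq\emptyset$. Let $\{(x^k,y^k,\lambda^k)\}$ be generated by the augmented Lagrangian method with penalty parameters $\{r_k\}$, and suppose that the set $\omega$ of accumulation points of $\{(x^k,y^k)\}$ is nonempty. Then for every $\varepsilon>0$ there exists a subsequence (infinite index set) $N\subset\mathbb{N}$ such that, for every $k\in N$, $$(x^k,y^k)\in\mathrm{argmin}_{x\in\mathbb{R}^n,\,y\in K}\,l_{r_{k-1}}(x,y,\lambda^{k-1})$$ and $$\|\mathrm{D}g(x^k)^*(g(x^k)-y^k)\|\le\varepsilon\quad\text{and}\quad\|\Pi_K(g(x^k))-y^k\|\le\varepsilon.$$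
   Context: Standing setting: $\mathcal{Y}$ is a finite dimensional Hilbert space, $K\subset\mathcal{Y}$ is a nonempty closed convex set, $f:\mathbb{R}^n\to\mathbb{R}$ is convex and continuously differentiable, $g:\mathbb{R}^n\to\mathcal{Y}$ is continuously differentiable, and $G_K(x)=-g(x)+K$ is graph-convex, i.e. $\{(x,s)\in\mathbb{R}^n\times\mathcal{Y}: g(x)+s\in K\}$ is convex. $\mathcal{S}=\{s\in\mathcal{Y}:\exists x\in\mathbb{R}^n,\ g(x)+s\in K\}$ is assumed closed with $0\notin\mathcal{S}$, and $\bar s=\mathrm{argmin}\{\frac12\|s\|^2: s\in\mathcal{S}\}$. For $s\in\mathcal{Y}$, $\mathrm{P}(s)$ is the problem $\min f(x)$ s.t. $g(x)+s\in K$, with optimal value $\mathrm{val}\,\mathrm{P}(s)=\nu(s)=\inf\{f(x): g(x)+s\in K\}$ (with $\inf\emptyset=+\infty$). $\theta(\lambda)=-\inf_{x\in\mathbb{R}^n,\,y\in K}[f(x)+\langle\lambda,g(x)-y\rangle]$; $\mathrm{D}(s)$ is the dual problem $\max_{\lambda\in\mathcal{Y}}[\langle s,\lambda\rangle-\theta(\lambda)]$ and $\mathrm{Sol}\,\mathrm{D}(s)$ its set of optimal solutions. The augmented Lagrangian is $l_r(x,y,\lambda)=f(x)+\langle\lambda,g(x)-y\rangle+\frac r2\|g(x)-y\|^2$. $\mathrm{D}g(x)^*$ is the adjoint of the derivative of $g$ at $x$, and $\Pi_K$ is the metric projection onto $K$. Augmented Lagrangian method: start with $\lambda^0\in\mathcal{Y}$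 and $r_0>0$; for $k=0,1,2,\dots$: (1) let $(x^{k+1},y^{k+1})$ be a solution of $\min_{x\in\mathbb{R}^n,\,y\in K}l_{r_k}(x,y,\lambda^k)$; (2) set $\lambda^{k+1}=\lambda^k+r_k(g(x^{k+1})-y^{k+1})$; (3) choose $r_{k+1}\ge r_k$. The generated infinite sequence is considered (no stopping). $\omega$ is the set of all limits of convergent subsequences of $\{(x^k,y^k)\}$. *)

(* Defs.v *)
From HB Require Import structures.
From mathcomp Require Import all_boot all_order all_algebra.
From mathcomp Require Import all_classical all_reals all_analysis.
Set Implicit Arguments.
Unset Strict Implicit.
Unset Printing Implicit Defensive.
Import Order.TTheory GRing.Theory Num.Theory.
Import numFieldNormedType.Exports.
Local Open Scope classical_set_scope.
Local Open Scope ring_scope.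

Definition argmin {T : Type} {d : Order.disp_t} {V : porderType d}
    (A : set T) (phi : T -> V) : set T :=
  [set a | A a /\ forall b, A b -> (phi a <= phi b)%O].

Definition argmax {T : Type} {d : Order.disp_t} {V : porderType d}
    (A : set T) (phi : T -> V) : set T :=
  [set a | A a /\ forall b, A b -> (phi b <= phi a)%O].

(* [Y] is a finite dimensional Hilbert space with inner product [ip]: the norm
   (hence the topology) of [Y] is the one induced by [ip]. Completeness is
   automatic in finite dimension. *)
Definition findim_hilbert {R : realType} (Y : normedModType R)
    (ip : {dot Y for (@idfun R)}) : Prop :=
  (forall y : Y, `|y| = Num.sqrt (ip y y)) /\
  (exists (m : nat) (b : 'I_m -> Y),
     forall y : Y, exists c : 'I_m -> R, y = \sum_(i < m) c i *: b i).

(* The last clause is continuity of [x |-> 'd F x] in operator norm. *)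
Definition continuously_differentiable {R : realType} {V W : normedModType R}
    (F : V -> W) : Prop :=
  (forall x, differentiable F x) /\
  (forall (x : V) (e : R), 0 < e ->
     \forall z \near x, forall v : V, `|'d F z v - 'd F x v| <= e * `|v|).

Definition lower_semicontinuous_at {R : realType} {X : topologicalType}
    (F : X -> \bar R) (x : X) : Prop :=
  forall a : R, (a%:E < F x)%E -> \forall z \near x, (a%:E < F z)%E.

(* The library norm of ['rV[R]_n] is the sup norm, so the Euclidean structure
   of [R^n] is given separately. *)
Definition euclidean_dot {R : realType} {n : nat} (u v : 'rV[R]_n) : R :=
  \sum_(i < n) u 0 i * v 0 i.

Definition euclidean_norm {R : realType} {n : nat} (u : 'rV[R]_n) : R :=
  Num.sqrt (euclidean_dot u u).

(* Coordinates in the standard basis of the adjoint of [L], applied to [y];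
   [adjointP] is the defining identity. *)
Definition adjoint {R : realType} {n : nat} {Y : normedModType R}
    (ip : {dot Y for (@idfun R)}) (L : 'rV[R]_n -> Y) (y : Y) : 'rV[R]_n :=
  \row_(i < n) ip y (L (delta_mx 0 i)).

Lemma adjointP {R : realType} {n : nat} {Y : normedModType R}
    (ip : {dot Y for (@idfun R)}) (L : {linear 'rV[R]_n -> Y}) (y : Y)
    (v : 'rV[R]_n) :
  euclidean_dot (adjoint ip L y) v = ip y (L v).
Proof.
rewrite [in RHS](row_sum_delta v) linear_sum linear_sum /=.
by apply: eq_bigr => i _; rewrite mxE linearZ linearZr_LR /= mulrC.
Qed.

(* Metric projection; the default value [0] is never reached when [K] is
   nonempty, closed and convex in a finite dimensional Hilbert space. *)
Definition metric_proj {R : realType} {Y : normedModType R} (K : set Y)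
    (z : Y) : Y :=
  xget 0 (argmin K (fun p => `|z - p|)).

Section Problem.
Context {R : realType} {n : nat} {Y : normedModType R}.
Variables (ip : {dot Y for (@idfun R)}) (K : set Y).
Variables (f : 'rV[R]_n -> R) (g : 'rV[R]_n -> Y).

Definition graph_convex : Prop :=
  convex_set (M := ('rV[R]_n * Y)%type) [set p | K (g p.1 + p.2)].

Definition shifts : set Y := [set s | exists x, K (g x + s)].

Definition nu (s : Y) : \bar R :=
  ereal_inf [set (f x)%:E | x in [set x | K (g x + s)]].

Definition theta (lambda : Y) : \bar R :=
  (- ereal_inf [set (f p.1 + ip lambda (g p.1 - p.2))%:E |
                p in [set p : 'rV[R]_n * Y | K p.2]])%E.

Definition SolD (s : Y) : set Y :=
  argmax setT (fun lambda => (ip s lambda)%:E - theta lambda)%E.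

Definition aug_lagrangian (r : R) (lambda : Y) (p : 'rV[R]_n * Y) : R :=
  f p.1 + ip lambda (g p.1 - p.2) + r / 2 * `|g p.1 - p.2| ^+ 2.

Definition alm_argmin (r : R) (lambda : Y) : set ('rV[R]_n * Y) :=
  argmin [set p | K p.2] (aug_lagrangian r lambda).

(* [x 0] and [y 0] are not produced by the method and are unconstrained. *)
Definition generated_by_alm (x : nat -> 'rV[R]_n) (y lambda : nat -> Y)
    (r : nat -> R) : Prop :=
  0 < r 0%N /\
  forall k : nat,
    [/\ alm_argmin (r k) (lambda k) (x k.+1, y k.+1),
        lambda k.+1 = lambda k + r k *: (g (x k.+1) - y k.+1) &
        r k <= r k.+1].

End Problem.

Definition subseq_limits {T : topologicalType} (u : nat -> T) : set T :=
  [set l | exists phi : nat -> nat,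
     {homo phi : i j / (i < j)%N} /\ u (phi i) @[i --> \oo] --> l].

(* Main.v *)
Require Import Defs.
From HB Require Import structures.
From mathcomp Require Import all_boot all_order all_algebra.
From mathcomp Require Import all_classical all_reals all_analysis.
From mathcomp Require Import ring lra.
Set Implicit Arguments.
Unset Strict Implicit.
Unset Printing Implicit Defensive.
Import Order.TTheory GRing.Theory Num.Theory.
Import numFieldNormedType.Exports.
Local Open Scope classical_set_scope.
Local Open Scope ring_scope.

(** The shifts [s_k = y_k - g (x_k)] produced by the augmented Lagrangian
method converge to the least-norm shift [sbar]; the two estimates are the
optimality conditions of [sbar], read off at an accumulation point.

Convergence of the shifts. Convexity turns the minimality of
[(x_(k+1), y_(k+1))] for the augmented Lagrangian at [lambda_k] into its
minimality for the ordinary Lagrangian at [lambda_(k+1)]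
([alm_argmin_lagrangian]); in dual terms, [s_(k+1)] is a subgradient of [theta]
at [lambda_(k+1)], and [lambda_(k+1) = lambda_k - r_k s_(k+1)] is a proximal
step for [theta]. A solution [lbar] of D(sbar) satisfies
[sbar \in d theta (lbar)], so monotonicity of the subdifferential gives
[<s_(k+1) - sbar, lambda_(k+1) - lbar> >= 0] ([SolD_monotone]). The multipliers
[lambda_k] may diverge, because 0 is not a feasible shift, but only in the
direction [- sbar]; the drift is removed by setting
[mu_k = lambda_k + (r_0 + ... + r_(k-1)) sbar]. Since [sbar] is the projection
of 0 onto the convex set of shifts, [<s - sbar, sbar> >= 0] for every shift
([min_shift_variational]), and therefore
[[
  |mu_(k+1) - lbar|^2 + r_k^2 |s_(k+1) - sbar|^2 <= |mu_k - lbar|^2.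
]]
As [r_k >= r_0 > 0], telescoping yields [s_k --> sbar] ([alm_shifts_cvg]).

Stationarity. At an accumulation point [(x, y)] one has [y - g x = sbar], hence
the displacement [x' |-> y - g x'] has minimal norm at [x], so that
[Dg(x)^* sbar = 0] ([min_shift_stationary]); continuity of [g] and [Dg] carries
this back to the subsequence.

Projection. If [p] is the projection of [g (x_k)] onto [K], then [p - g (x_k)]
is a shift, hence at least as long as [sbar], while [y_k - g (x_k)] is only
slightly longer than [sbar]. The parallelogram identity then forces [p] and
[y_k] to be close ([metric_proj_close]). That the projection exists is a
compactness argument in coordinates ([metric_projP]). *)

(** * Inner product *)

Lemma dotC (R : realType) (Y : normedModType R) (ip : {dot Y for (@idfun R)})
    (u v : Y) : ip u v = ip v u.
Proof. by rewrite hermC /= expr0 mul1r. Qed.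

Lemma sqr_norm_dot (R : realType) (Y : normedModType R)
    (ip : {dot Y for (@idfun R)})
    (ipE : forall y : Y, `|y| = Num.sqrt (ip y y)) (u : Y) :
  `|u| ^+ 2 = ip u u.
Proof.
rewrite ipE sqr_sqrtr//; have [->|u0] := eqVneq u 0; first by rewrite linear0l.
exact/ltW/neq0_dnorm_gt0.
Qed.

Lemma sqr_normD (R : realType) (Y : normedModType R)
    (ip : {dot Y for (@idfun R)})
    (ipE : forall y : Y, `|y| = Num.sqrt (ip y y)) (u v : Y) :
  `|u + v| ^+ 2 = `|u| ^+ 2 + 2 * ip u v + `|v| ^+ 2.
Proof.
by rewrite !(sqr_norm_dot ipE) linearDl !linearD /= (dotC ip v u); ring.
Qed.

(** By polarization, continuity of the inner product is inherited from that of
the norm. *)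
Lemma cvg_dot (R : realType) (Y : normedModType R)
    (ip : {dot Y for (@idfun R)})
    (ipE : forall y : Y, `|y| = Num.sqrt (ip y y))
    (T : Type) (F : set_system T) (FF : Filter F) (u v : T -> Y) (a b : Y) :
  u t @[t --> F] --> a -> v t @[t --> F] --> b ->
  ip (u t) (v t) @[t --> F] --> ip a b.
Proof.
move=> ua vb.
have polar c d : ip c d = 2^-1 * (`|c + d| ^+ 2 - `|c| ^+ 2 - `|d| ^+ 2).
  by rewrite (sqr_normD ipE); field.
rewrite polar; under eq_cvg do rewrite polar.
have sqn w c : w t @[t --> F] --> c -> `|w t : Y| ^+ 2 @[t --> F] --> `|c| ^+ 2.
  by move=> wc; rewrite expr2; under eq_cvg do rewrite expr2;
     apply: cvgM; apply: cvg_norm.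
apply: cvgM; first exact: cvg_cst.
by apply: cvgB; [apply: cvgB; apply: sqn => //; apply: cvgD|exact: sqn].
Qed.

(** * First-order consequences of convexity *)

(** The form in which every minimality condition below is differentiated: along
a segment the increment is at most [t * a + t ^+ 2 * b], and dividing by [t]
before letting it tend to 0 leaves [a]. *)
Lemma first_order_ge0 (R : realType) (a b : R) :
  (forall t, 0 < t -> t < 1 -> 0 <= t * a + t ^+ 2 * b) -> 0 <= a.
Proof.
move=> H; rewrite leNgt; apply/negP => a0.
have D0 : 0 < 2 * (`|a| + `|b| + 1) by rewrite mulr_gt0// ltr_wpDl// addr_ge0.
(* [t] is chosen so that [t * b] offsets at most half of [a]. *)
pose t := - a / (2 * (`|a| + `|b| + 1)).
have t0 : 0 < t by rewrite divr_gt0// oppr_gt0.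
have t1 : t < 1.
  rewrite ltr_pdivrMr// mul1r; have := ler_norm (- a); rewrite normrN.
  by have := normr_ge0 b; lra.
have := H t t0 t1; have -> : t * a + t ^+ 2 * b = t * (a + t * b) by ring.
rewrite pmulr_rge0//; apply/negP; rewrite -ltNge.
have tb : t * b <= - a / 2.
  apply: (@le_trans _ _ (t * `|b|)); first by rewrite ler_pM2l// ler_norm.
  rewrite /t mulrAC ler_pdivrMr//.
  have := normr_ge0 a; have := normr_ge0 b; nra.
lra.
Qed.

Lemma convex_setP (R : realType) (V : lmodType R) (A : set V) :
  convex_set A -> forall (t : R) a b, 0 < t -> t < 1 -> A a -> A b ->
  A (t *: b + (1 - t) *: a).
Proof.
move=> Acvx t a b /ltW t0 /ltW t1 Aa Ab.
by have := Acvx b a (Itv01 t0 t1); rewrite !inE /=; apply.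
Qed.

Lemma graph_convexP (R : realType) (n : nat) (Y : normedModType R)
    (K : set Y) (g : 'rV[R]_n -> Y) :
  graph_convex K g -> forall (t : R) x x' s s', 0 < t -> t < 1 ->
  K (g x + s) -> K (g x' + s') ->
  K (g (t *: x' + (1 - t) *: x) + (t *: s' + (1 - t) *: s)).
Proof.
move=> gc t x x' s s' t0 t1 Ks Ks'.
exact: (convex_setP gc (a := (x, s)) (b := (x', s')) t0 t1).
Qed.

Lemma convex_functionP (R : realType) (n : nat) (f : 'rV[R]_n -> R) :
  convex_function (E := 'rV[R]_n) setT f -> forall (t : R) x x',
  0 < t -> t < 1 -> f (t *: x' + (1 - t) *: x) <= t * f x' + (1 - t) * f x.
Proof.
move=> fc t x x' /ltW t0 /ltW t1.
by have := fc (Itv01 t0 t1) x' x; rewrite !inE /=; apply.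
Qed.

(** Optimality of an augmented Lagrangian step for the ordinary Lagrangian at the
updated multiplier. Graph-convexity makes the segment between two pairs
(point, shift) feasible; along it the quadratic penalty contributes to first
order only its gradient [r *: (g x - y)], which is what the multiplier update
adds to [l]. *)
Lemma alm_argmin_lagrangian (R : realType) (n : nat) (Y : normedModType R)
    (ip : {dot Y for (@idfun R)})
    (ipE : forall y : Y, `|y| = Num.sqrt (ip y y)) (K : set Y)
    (f : 'rV[R]_n -> R) (g : 'rV[R]_n -> Y)
    (fcvx : convex_function (E := 'rV[R]_n) setT f)
    (gcvx : graph_convex K g) (r : R) (l : Y) (p : 'rV[R]_n * Y) :
  alm_argmin ip K f g r l p ->
  forall q, K q.2 ->
    f p.1 + ip (l + r *: (g p.1 - p.2)) (g p.1 - p.2) <=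
    f q.1 + ip (l + r *: (g p.1 - p.2)) (g q.1 - q.2).
Proof.
case: p => x y [/= Ky ymin] [x' y'] /= Ky'; rewrite -subr_ge0.
apply: (@first_order_ge0 _ _ (r / 2 * `|g x' - y' - (g x - y)| ^+ 2)) => t t0 t1.
have Kt := @graph_convexP _ _ _ _ _ gcvx t x x' (y - g x) (y' - g x') t0 t1.
rewrite !subrKC in Kt.
have := ymin (t *: x' + (1 - t) *: x, _) (Kt Ky Ky').
rewrite /aug_lagrangian/= opprD addNKr -(opprB (g x)) -(opprB (g x')).
move: (g x - y) (g x' - y') => d d'.
have -> : - (t *: - d' + (1 - t) *: - d) = d + t *: (d' - d).
  by rewrite !scalerN -opprD opprK scalerBl scale1r scalerBr addrCA.
have -> : ip l (d + t *: (d' - d)) = ip l d + t * (ip l d' - ip l d).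
  by rewrite linearD linearZ linearB.
have -> : ip (l + r *: d) d' = ip l d' + r * ip d d'.
  by rewrite linearDl linearZl_LR.
have -> : ip (l + r *: d) d = ip l d + r * ip d d.
  by rewrite linearDl linearZl_LR.
have -> : `|d + t *: (d' - d)| ^+ 2 =
    ip d d + 2 * t * (ip d d' - ip d d) + t ^+ 2 * `|d' - d| ^+ 2.
  rewrite (sqr_normD ipE) (sqr_norm_dot ipE d) normrZ (gtr0_norm t0) exprMn.
  by rewrite linearZ linearB /= mulrA.
rewrite (sqr_norm_dot ipE d); have := convex_functionP fcvx x x' t0 t1.
lra.
Qed.
(** The obtuse-angle characterization of [sbar] as the projection of 0 onto the
set of shifts, which is convex as the projection of a convex graph. *)
Lemma min_shift_variational (R : realType) (n : nat) (Y : normedModType R)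
    (ip : {dot Y for (@idfun R)})
    (ipE : forall y : Y, `|y| = Num.sqrt (ip y y)) (K : set Y)
    (g : 'rV[R]_n -> Y) (gcvx : graph_convex K g) (sbar : Y) :
  argmin (shifts K g) (fun s : Y => 2^-1 * `|s| ^+ 2) sbar ->
  forall s, shifts K g s -> 0 <= ip (s - sbar) sbar.
Proof.
move=> [[x Kx] smin] s [x' Kx'].
apply: (@first_order_ge0 _ _ (2^-1 * `|s - sbar| ^+ 2)) => t t0 t1.
have := smin _ (ex_intro _ _ (graph_convexP gcvx t0 t1 Kx Kx')).
have -> : t *: s + (1 - t) *: sbar = sbar + t *: (s - sbar).
  by rewrite scalerBl scale1r scalerBr addrCA.
have -> : `|sbar + t *: (s - sbar)| ^+ 2 =
    `|sbar| ^+ 2 + 2 * t * ip (s - sbar) sbar + t ^+ 2 * `|s - sbar| ^+ 2.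
  rewrite (sqr_normD ipE) normrZ (gtr0_norm t0) exprMn linearZ /= mulrA.
  by rewrite (dotC ip sbar).
lra.
Qed.

(** * Convergence of the shifts *)

Lemma theta_ge (R : realType) (n : nat) (Y : normedModType R)
    (ip : {dot Y for (@idfun R)}) (K : set Y)
    (f : 'rV[R]_n -> R) (g : 'rV[R]_n -> Y) (l : Y) (p : 'rV[R]_n * Y) :
  K p.2 ->
  ((- (f p.1 + ip l (g p.1 - p.2)))%:E <= theta ip K f g l)%E.
Proof.
by move=> Kp; rewrite /theta EFinN leeN2; apply: ereal_inf_lbound; exists p.
Qed.

(** By weak duality, a minimizer of the Lagrangian makes [theta] finite at its
multiplier and computes it. *)
Lemma theta_attained (R : realType) (n : nat) (Y : normedModType R)
    (ip : {dot Y for (@idfun R)}) (K : set Y)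
    (f : 'rV[R]_n -> R) (g : 'rV[R]_n -> Y) (l : Y) (p : 'rV[R]_n * Y) :
  K p.2 ->
  (forall q, K q.2 ->
     f p.1 + ip l (g p.1 - p.2) <= f q.1 + ip l (g q.1 - q.2)) ->
  theta ip K f g l = (- (f p.1 + ip l (g p.1 - p.2)))%:E.
Proof.
move=> Kp pmin; apply/eqP; rewrite eq_le theta_ge// andbT.
rewrite /theta EFinN leeN2; apply: le_ereal_inf_tmp => _ [q Kq <-].
by rewrite lee_fin pmin.
Qed.

(** Monotonicity of the subdifferential of [theta]: [s] is a subgradient at
[lbar] because [lbar] solves D(s), and [p.2 - g p.1] is one at [l] because [p]
minimizes the Lagrangian. Adding the two subgradient inequalities gives the
claim. *)
Lemma SolD_monotone (R : realType) (n : nat) (Y : normedModType R)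
    (ip : {dot Y for (@idfun R)}) (K : set Y)
    (f : 'rV[R]_n -> R) (g : 'rV[R]_n -> Y) (s l lbar : Y)
    (p : 'rV[R]_n * Y) :
  SolD ip K f g s lbar -> K p.2 ->
  (forall q, K q.2 ->
     f p.1 + ip l (g p.1 - p.2) <= f q.1 + ip l (g q.1 - q.2)) ->
  0 <= ip (p.2 - g p.1 - s) (l - lbar).
Proof.
move=> [_ /(_ l I)] + Kp pmin; rewrite (theta_attained Kp pmin).
have := theta_ge ip f g lbar Kp.
have -> : ip (p.2 - g p.1 - s) (l - lbar) =
    ip l (p.2 - g p.1) - ip lbar (p.2 - g p.1) - ip s l + ip s lbar.
  rewrite linearBl !linearB /= !(dotC ip l) !(dotC ip lbar) /= !linearBl.
  ring.
rewrite -(opprB p.2); move: (p.2 - g p.1) => d; rewrite !linearN /=.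
(* An infinite value of [theta] at [lbar] would contradict either weak duality or
   the optimality of [lbar] against the finite dual value at [l]. *)
by case: (theta _ _ _ _ _) => [t| |]; rewrite ?lee_fin //=; lra.
Qed.

Lemma telescoping_cvg0 (R : realType) (D e : R^nat) :
  (forall k, 0 <= D k) -> (forall k, 0 <= e k) ->
  (forall k, e k + D k.+1 <= D k) -> e @ \oo --> 0.
Proof.
move=> D0 e0 De.
have : cvgn D.
  apply: nonincreasing_is_cvgn; last by exists 0 => _ [k _ <-].
  apply/nonincreasing_seqP => k; apply: le_trans (De k).
  by rewrite lerDr.
move=> /cvg_ex[l Dl].
have Dd : D k - D k.+1 @[k --> \oo] --> 0.
  rewrite -(subrr l); apply: cvgB => //.
  by rewrite (cvg_shiftS D).
apply: (squeeze_cvgr _ (cvg_cst 0) Dd).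
by near=> k; rewrite e0 /= lerBrDr.
Unshelve. all: by end_near. Qed.

(** Fejér monotonicity of the corrected multipliers [mu k] with respect to
[lbar]; each decrease dominates the squared distance of the next shift to
[sbar]. *)
Lemma alm_shifts_cvg (R : realType) (n : nat) (Y : normedModType R)
    (ip : {dot Y for (@idfun R)})
    (ipE : forall y : Y, `|y| = Num.sqrt (ip y y)) (K : set Y)
    (f : 'rV[R]_n -> R) (g : 'rV[R]_n -> Y) (sbar : Y)
    (x : nat -> 'rV[R]_n) (y lambda : nat -> Y) (r : nat -> R)
    (fcvx : convex_function (E := 'rV[R]_n) setT f)
    (gcvx : graph_convex K g) :
  argmin (shifts K g) (fun s : Y => 2^-1 * `|s| ^+ 2) sbar ->
  SolD ip K f g sbar !=set0 ->
  generated_by_alm ip K f g x y lambda r ->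
  y k - g (x k) @[k --> \oo] --> sbar.
Proof.
move=> smin [lbar lbarP] [r0 alm].
have rk k : r 0%N <= r k.
  by elim: k => // k IH; apply: (le_trans IH); have [] := alm k.
(* Adding the accumulated multiple of [sbar] cancels the divergence of
   [lambda k], which moves by [- r k *: s k.+1]. *)
pose mu k := lambda k + (\sum_(i < k) r i) *: sbar.
pose s k := y k - g (x k).
have decr k : r 0%N ^+ 2 * `|s k.+1 - sbar| ^+ 2 + `|mu k.+1 - lbar| ^+ 2 <=
    `|mu k - lbar| ^+ 2.
  have [am lamE _] := alm k.
  have Ky := am.1; rewrite /= in Ky.
  have min := alm_argmin_lagrangian ipE fcvx gcvx am; rewrite /= -lamE in min.
  have mono := SolD_monotone lbarP (Ky : K (x k.+1, y k.+1).2) min.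
  have var : 0 <= ip (s k.+1 - sbar) sbar.
    apply: (min_shift_variational ipE gcvx smin).
    by exists (x k.+1); rewrite subrKC.
  have muE : mu k - lbar = (mu k.+1 - lbar) + r k *: (s k.+1 - sbar).
    rewrite /mu lamE -(opprB (y k.+1)) -/(s _) big_ord_recr/= scalerDl scalerN.
    move: (s k.+1) (lambda k) ((\sum_(i < k) r i) *: sbar) => d L c.
    rewrite scalerBr !addrA.
    rewrite (addrAC L (- _)) (addrAC _ (- (r k *: d)) (r k *: sbar)).
    rewrite (addrAC _ (- (r k *: d)) (- lbar)) subrK.
    by rewrite (addrAC _ (r k *: sbar)) addrK.
  rewrite muE [leRHS](sqr_normD ipE) normrZ (ger0_norm (ltW _)); last first.
    exact: lt_le_trans (rk k).
  have cross : 0 <= ip (mu k.+1 - lbar) (s k.+1 - sbar).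
    rewrite (dotC ip) /mu (addrAC (lambda _)).
    rewrite (linearD (ip (s k.+1 - sbar))) linearZ /=.
    rewrite addr_ge0// mulr_ge0//.
    by rewrite sumr_ge0// => i _; apply: le_trans (rk i); exact: ltW.
  rewrite linearZ /= exprMn -[leRHS]addrA [leLHS]addrC lerD2l.
  have : r 0%N ^+ 2 <= r k ^+ 2.
    by rewrite ler_sqr ?nnegrE// ?rk// ltW// (lt_le_trans r0).
  move: (sqr_ge0 `|s k.+1 - sbar|) => n0 rr.
  rewrite ler_wpDl//; last by rewrite ler_wpM2r.
  by rewrite mulr_ge0// mulr_ge0// ltW// (lt_le_trans r0).
have h : r 0%N ^+ 2 * `|s k.+1 - sbar| ^+ 2 @[k --> \oo] --> 0.
  apply: (@telescoping_cvg0 _ (fun k => `|mu k - lbar| ^+ 2)) => // k.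
  by rewrite mulr_ge0// sqr_ge0.
rewrite -(cvg_shiftS s); apply/cvgrPdist_le => e e0.
have re0 : 0 < r 0%N ^+ 2 * e ^+ 2 by rewrite mulr_gt0// exprn_gt0.
move/cvgr_norm_le : h => /(_ (r 0%N ^+ 2 * e ^+ 2)); rewrite normr0 => /(_ re0).
apply: filterS => k.
rewrite ger0_norm; last by rewrite mulr_ge0// sqr_ge0.
rewrite /= [`|sbar - _|]distrC ler_pM2l ?exprn_gt0// ler_sqr ?nnegrE//.
exact: ltW.
Qed.
(** * Optimality conditions of the least-norm shift *)

(** For every [h], the vector [g x + sbar - g (x + h v)] is again a shift, hence
at least as long as [sbar]; expanding the square for small [h > 0] shows that
[sbar] has nonpositive product with every directional derivative, and replacing
[v] by [- v] gives equality. *)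
Lemma min_shift_stationary (R : realType) (n : nat) (Y : normedModType R)
    (ip : {dot Y for (@idfun R)})
    (ipE : forall y : Y, `|y| = Num.sqrt (ip y y)) (K : set Y)
    (g : 'rV[R]_n -> Y) (sbar : Y) (x : 'rV[R]_n) :
  differentiable g x ->
  argmin (shifts K g) (fun s : Y => 2^-1 * `|s| ^+ 2) sbar ->
  K (g x + sbar) -> forall v, ip sbar ('d g x v) = 0.
Proof.
move=> dg [_ smin] Kx.
suff le0 v : ip sbar ('d g x v) <= 0.
  move=> v; apply/eqP; rewrite eq_le le0 /=.
  by have := le0 (- v); rewrite !linearN /= oppr_le0.
pose q (h : R) := h^-1 *: (g (h *: v + x) - g x).
have qv : q h @[h --> 0^'+] --> 'd g x v.
  apply: cvg_dnbhs_at_right; rewrite -(deriveE v dg).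
  exact: (@diff_derivable _ _ _ g x v dg).
have lim : 2 * ip sbar (q h) - h * `|q h| ^+ 2 @[h --> 0^'+] -->
    2 * ip sbar ('d g x v) - 0 * `|'d g x v| ^+ 2.
  apply: cvgB.
    apply: cvgM; first exact: cvg_cst.
    by apply: (cvg_dot ipE) => //; exact: cvg_cst.
  apply: cvgM; first exact/cvg_at_right_filter/cvg_id.
  by rewrite expr2; under eq_cvg do rewrite expr2; apply: cvgM; exact: cvg_norm.
rewrite mul0r subr0 in lim.
rewrite -(pmulr_rle0 _ (ltr0Sn R 1)).
apply: (closed_cvg _ (@closed_le R 0) _ _ lim).
near=> h.
have h0 : 0 < h by [].
have gE : g x + sbar = g (h *: v + x) + (sbar - h *: q h).
  by rewrite /q scalerA mulfV ?gt_eqF// scale1r opprB addrCA subrKC addrC.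
rewrite gE in Kx; have := smin _ (ex_intro _ _ Kx).
rewrite ler_pM2l ?invr_gt0// (sqr_normD ipE) normrN normrZ (gtr0_norm h0).
rewrite linearN linearZ /= => H.
have : 0 <= h * (h * `|q h| ^+ 2 - 2 * ip sbar (q h)) by lra.
by rewrite pmulr_rge0// subr_ge0 subr_le0.
Unshelve. all: by end_near. Qed.

(** The midpoint of [p] and [y] lies in [K], so it is no closer to [g x] than
[p], and [p - g x] is a shift, hence no shorter than [sbar]. The parallelogram
identity combines these two facts. *)
Lemma metric_proj_close (R : realType) (n : nat) (Y : normedModType R)
    (ip : {dot Y for (@idfun R)})
    (ipE : forall y : Y, `|y| = Num.sqrt (ip y y)) (K : set Y)
    (Kcvx : convex_set K)
    (g : 'rV[R]_n -> Y) (sbar : Y) (x : 'rV[R]_n) (y p : Y) :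
  argmin (shifts K g) (fun s : Y => 2^-1 * `|s| ^+ 2) sbar ->
  K y -> argmin K (fun p => `|g x - p|) p ->
  `|p - y| ^+ 2 <= 2 * (`|y - g x| ^+ 2 - `|sbar| ^+ 2).
Proof.
move=> [_ smin] Ky [Kp pmin].
have [h0 h1] : 0 < (2^-1 : R) /\ (2^-1 : R) < 1 by split; lra.
have := pmin _ (convex_setP Kcvx h0 h1 Ky Kp).
have -> : 1 - (2^-1 : R) = 2^-1 by lra.
have -> : g x - (2^-1 *: p + 2^-1 *: y) = 2^-1 *: ((g x - p) + (g x - y)).
  rewrite addrACA -opprD -scalerDr [RHS]scalerBr -mulr2n.
  by rewrite -(scaler_nat 2 (g x)) scalerA mulVf ?pnatr_eq0// scale1r.
have : `|sbar| <= `|g x - p|.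
  have := smin (p - g x).
  rewrite (distrC p) ler_pM2l ?invr_gt0// ler_sqr ?nnegrE//.
  by apply; exists x; rewrite subrKC.
have -> : p - y = (g x - y) - (g x - p).
  by rewrite opprB [RHS]addrC subrKA.
rewrite (distrC y).
move: (g x - p) (g x - y) => a b sa ab.
have sqr_le c d : `|c : Y| <= `|d : Y| -> `|c| ^+ 2 <= `|d| ^+ 2.
  by rewrite ler_sqr ?nnegrE.
move: (sqr_le _ _ sa) (sqr_le _ _ ab); rewrite normrZ exprMn (sqr_normD ipE a).
rewrite (sqr_normD ipE b) normrN linearN /= (dotC ip b) gtr0_norm//.
lra.
Qed.
(** * Existence of the metric projection *)

Definition lincomb (R : realType) (Y : normedModType R) (m : nat)
    (b : 'I_m -> Y) (c : 'rV[R]_m) : Y := \sum_(i < m) c 0 i *: b i.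

Lemma lincombB (R : realType) (Y : normedModType R) (m : nat)
    (b : 'I_m -> Y) (c d : 'rV[R]_m) :
  lincomb b (c - d) = lincomb b c - lincomb b d.
Proof.
by rewrite /lincomb -sumrB; apply: eq_bigr => i _; rewrite !mxE scalerBl.
Qed.

Lemma lincombZ (R : realType) (Y : normedModType R) (m : nat)
    (b : 'I_m -> Y) (t : R) (c : 'rV[R]_m) :
  lincomb b (t *: c) = t *: lincomb b c.
Proof.
by rewrite /lincomb scaler_sumr; apply: eq_bigr => i _; rewrite mxE scalerA.
Qed.

Lemma lincomb_continuous (R : realType) (Y : normedModType R) (m : nat)
    (b : 'I_m -> Y) : continuous (lincomb b).
Proof.
move=> c; have FF := nbhs_filter c.
apply: (@cvg_big _ _ _ _ _ _ _ (nbhs c)) => [|i _].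
  by move=> u; apply: add_continuous.
apply: cvgZr_tmp; exact: coord_continuous.
Qed.

(** A spanning family of minimal size is free: a nontrivial relation with
[c 0 i != 0] would allow the [i]-th vector to be dropped. *)
Lemma findim_basis (R : realType) (Y : normedModType R) :
  (exists (m : nat) (b : 'I_m -> Y),
     forall y : Y, exists c : 'I_m -> R, y = \sum_(i < m) c i *: b i) ->
  exists (m : nat) (b : 'I_m -> Y), (forall y, exists c, y = lincomb b c) /\
    (forall c, lincomb b c = 0 -> c = 0).
Proof.
move=> [m0 [b0 span0]].
pose spanning m := exists b : 'I_m -> Y, forall y, exists c, y = lincomb b c.
have ex : exists m, `[< spanning m >].
  exists m0; apply/asboolP; exists b0 => y; have [c ->] := span0 y.
  by exists (\row_i c i); apply: eq_bigr => i _; rewrite mxE.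
case: (ex_minnP ex) => m /asboolP[b span] min.
exists m, b; split => // c c0; apply/rowP => i; rewrite mxE; apply/eqP.
apply/negPn/negP => ci.
case: m b span min c c0 i ci => [|m] b span min c c0 i ci.
  by case: i ci.
suff : (m.+1 <= m)%N by rewrite ltnn.
apply: min; apply/asboolP; exists (b \o lift i) => y; have [d ->] := span y.
(* Subtracting this multiple of the relation [c] cancels the [i]-th coordinate
   of [d] without changing the vector it represents. *)
exists (\row_j (d - (d 0 i / c 0 i) *: c) 0 (lift i j)).
rewrite -[LHS]subr0 -(scaler0 _ (d 0 i / c 0 i)) -c0 -lincombZ -lincombB.
rewrite {1}/lincomb (bigD1_ord i)//= !mxE divfK// subrr scale0r add0r.
by apply: eq_bigr => j _; rewrite !mxE.
Qed.

(** The norm of [lincomb b c] attains a positive minimum on the compact unit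
sphere of the coordinate space. *)
Lemma lincomb_coercive (R : realType) (Y : normedModType R) (m : nat)
    (b : 'I_m -> Y) : (forall c, lincomb b c = 0 -> c = 0) ->
  exists2 d : R, 0 < d & forall c, d * `|c| <= `|lincomb b c|.
Proof.
move=> inj; pose S := [set c : 'rV[R]_m | `|c| = 1].
have normc (c : 'rV[R]_m) : c != 0 -> S (`|c|^-1 *: c).
  by move=> c0; rewrite /S/= normrZ normfV normr_id mulVf ?normr_eq0.
(* The sphere is empty when [m = 0]. *)
have [[c0 Sc0]|noS] := pselect (S !=set0); last first.
  exists 1 => // c; suff -> : c = 0 by rewrite normr0 mulr0.
  by apply/eqP/negPn/negP => /normc Sc; apply: noS; exists (`|c|^-1 *: c).
have Scpt : compact S.
  apply: bounded_closed_compact.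
    exists 1; split => // M M1 c /= ->; exact: ltW.
  have -> : S = (fun c : 'rV[R]_m => `|c|) @^-1` [set 1] by [].
  apply: preimage_closed; last exact: closed_eq.
  by move=> c _; apply: norm_continuous.
have [|c Sc cmin] := compact_EVT_min (ex_intro _ _ Sc0) Scpt
    (f := fun c => `|lincomb b c|).
  apply: continuous_subspaceT => c.
  exact: (cvg_norm (@lincomb_continuous _ _ _ b c)).
have c_neq0 : c != 0.
  apply/eqP => cz; move: Sc; rewrite cz inE /S/= normr0 => /eqP.
  by rewrite eq_sym oner_eq0.
exists `|lincomb b c|.
  by rewrite normr_gt0; apply/eqP => /inj/eqP; rewrite (negbTE c_neq0).
move=> e; have [->|e0] := eqVneq e 0; first by rewrite normr0 mulr0.
have := cmin _ (mem_set (normc _ e0)).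
rewrite lincombZ normrZ normfV normr_id.
by rewrite [leRHS]mulrC ler_pdivlMr// normr_gt0.
Qed.

(** Coercivity makes the coordinates of the points of [K] at distance at most
[`|z - p0|] from [z] range over a compact set. *)
Lemma metric_projP (R : realType) (Y : normedModType R)
    (ip : {dot Y for (@idfun R)}) (hY : findim_hilbert ip) (K : set Y)
    (K0 : K !=set0) (Kcl : closed K) (z : Y) :
  argmin K (fun p => `|z - p|) (metric_proj K z).
Proof.
apply: xgetPex.
have [m [b [span inj]]] := findim_basis hY.2.
have [d d0 coer] := lincomb_coercive inj.
have [p0 Kp0] := K0.
pose dist c := `|z - lincomb b c|.
have distC : continuous dist.
  move=> c; have FF := nbhs_filter c.
  apply: cvg_norm; apply: cvgB; first exact: cvg_cst.
  exact: (@lincomb_continuous _ _ _ b c).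
pose C := lincomb b @^-1` K `&` dist @^-1` [set t | t <= `|z - p0|].
have C0 : C !=set0.
  by have [c p0E] := span p0; exists c; rewrite /C /dist/= -p0E.
have Ccl : closed C.
  apply: closedI.
    by apply: preimage_closed Kcl => c _; exact: lincomb_continuous.
  by apply: preimage_closed (@closed_le R `|z - p0|) => c _; exact: distC.
have Ccpt : compact C.
  apply: bounded_closed_compact => //.
  exists ((`|z| + `|z - p0|) / d); split; first exact: num_real.
  move=> M MM c [_ /= distc]; apply: le_trans (ltW MM).
  rewrite ler_pdivlMr// mulrC; apply: le_trans (coer c) _.
  rewrite -[lincomb b c](subKr z); apply: le_trans (ler_normB _ _) _.
  by rewrite lerD2l.
have [|c] := compact_EVT_min C0 Ccpt (f := dist).
  exact: continuous_subspaceT.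
rewrite inE => -[Kc distc] cmin; exists (lincomb b c); split => // p Kp.
have [le|gt] := leP `|z - p| `|z - p0|; last exact: le_trans distc (ltW gt).
have [e pE] := span p; have := cmin e; rewrite inE /dist -pE; apply.
by split; rewrite /= -?pE// /dist -pE.
Qed.

(** * Passage to the accumulation point *)

Lemma infinite_set_near_subseq (phi : nat -> nat) (N : set nat) :
  {homo phi : i j / (i < j)%N} -> (\forall i \near \oo, N (phi i)) ->
  infinite_set N.
Proof.
move=> phi_incr [i0 _ Ni] Nfin.
have phi_inj : injective phi by apply/incn_inj/leq_mono.
apply: infinite_nat.
apply: (@sub_finite_set _ _ (`I_i0 `|` phi @^-1` N)).
  by move=> i _; have [?|?] := ltnP i i0; [left|right; exact: Ni].
by rewrite finite_setU; split=> //; apply: finite_preimage => //; exact: in2W.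
Qed.

Lemma cvg_homo_infty (phi : nat -> nat) :
  {homo phi : i j / (i < j)%N} -> phi @ \oo --> \oo.
Proof.
move=> phi_incr.
have phi_ge i : (i <= phi i)%N.
  by elim: i => // i IH; apply: leq_ltn_trans IH _; exact: phi_incr.
apply/cvgnyPge => A; near=> i; apply: leq_trans (phi_ge i); near: i.
exact: nbhs_infty_ge.
Unshelve. all: by end_near. Qed.

Lemma cvg_diff_continuous (R : realType) (n : nat) (Y : normedModType R)
    (g : 'rV[R]_n -> Y) (gC1 : continuously_differentiable g)
    (T : Type) (F : set_system T) (FF : Filter F) (x : T -> 'rV[R]_n) a v :
  x t @[t --> F] --> a -> 'd g (x t) v @[t --> F] --> 'd g a v.
Proof.
move=> xa; apply/cvgrPdist_le => e e0.
have ve0 : 0 < e / (`|v| + 1) by rewrite divr_gt0// ltr_wpDl.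
have : \forall t \near F, forall w,
    `|'d g (x t) w - 'd g a w| <= e / (`|v| + 1) * `|w|.
  exact: (xa _ (gC1.2 a _ ve0)).
apply: filterS => t /(_ v).
move=> dist_le; rewrite distrC; apply: le_trans dist_le _.
by rewrite mulrAC ler_pdivrMr ?ltr_wpDl// ler_pM2l// lerDl.
Qed.

Lemma adjointE (R : realType) (n : nat) (Y : normedModType R)
    (ip : {dot Y for (@idfun R)}) (L : 'rV[R]_n -> Y) (w : Y) (i : 'I_n) :
  adjoint ip L w 0 i = ip w (L (delta_mx 0 i)).
Proof. by rewrite /adjoint mxE. Qed.

Lemma cvg_adjoint_norm (R : realType) (n : nat) (Y : normedModType R)
    (ip : {dot Y for (@idfun R)})
    (ipE : forall y : Y, `|y| = Num.sqrt (ip y y))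
    (g : 'rV[R]_n -> Y) (gC1 : continuously_differentiable g)
    (T : Type) (F : set_system T) (FF : Filter F)
    (x : T -> 'rV[R]_n) (u : T -> Y) a w :
  x t @[t --> F] --> a -> u t @[t --> F] --> w ->
  euclidean_norm (adjoint ip ('d g (x t)) (u t)) @[t --> F] -->
  euclidean_norm (adjoint ip ('d g a) w).
Proof.
move=> xa uw; rewrite /euclidean_norm.
apply: continuous_cvg; first exact: sqrt_continuous.
rewrite /euclidean_dot; apply: cvg_big => [|i _].
  by move=> z; apply: add_continuous.
have coord_cvg : (adjoint ip ('d g (x t)) (u t)) 0 i @[t --> F] -->
    (adjoint ip ('d g a) w) 0 i.
  have -> : (fun t => (adjoint ip ('d g (x t)) (u t)) 0 i) =
      (fun t => ip (u t) ('d g (x t) (delta_mx 0 i))).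
    apply/funext => t; exact: adjointE.
  rewrite [X in _ --> X]adjointE.
  apply: (cvg_dot ipE) => //.
  exact: cvg_diff_continuous.
exact: cvgM.
Qed.

Theorem theorem4p3 (R : realType) (n : nat) (Y : normedModType R)
    (ip : {dot Y for (@idfun R)}) (K : set Y)
    (f : 'rV[R]_n -> R) (g : 'rV[R]_n -> Y) (sbar : Y)
    (x : nat -> 'rV[R]_n) (y lambda : nat -> Y) (r : nat -> R)
    (hY : findim_hilbert ip)
    (hK0 : K !=set0) (hKcl : closed K) (hKcvx : convex_set K)
    (hfcvx : convex_function (E := 'rV[R]_n) setT f)
    (hfC1 : continuously_differentiable f)
    (hgC1 : continuously_differentiable g)
    (hgcvx : graph_convex K g)
    (hScl : closed (shifts K g)) (hS0 : ~ shifts K g 0)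
    (hsbar : argmin (shifts K g) (fun s : Y => 2^-1 * `|s| ^+ 2) sbar)
    (hsbar0 : sbar != 0)
    (hval : nu K f g sbar \is a fin_num)
    (hlsc : lower_semicontinuous_at (nu K f g) sbar)
    (hSolD : SolD ip K f g sbar !=set0)
    (halm : generated_by_alm ip K f g x y lambda r)
    (homega : subseq_limits (fun k => (x k, y k)) !=set0) :
  forall eps : R, 0 < eps ->
    exists N : set nat, infinite_set N /\
      forall k, N k ->
        [/\ (0 < k)%N,
            alm_argmin ip K f g (r k.-1) (lambda k.-1) (x k, y k),
            euclidean_norm (adjoint ip ('d g (x k)) (g (x k) - y k)) <= eps &
            `|metric_proj K (g (x k)) - y k| <= eps].
Proof.
move=> eps eps0; have ipE := hY.1.
have [[xs ys] [phi [phi_incr xy_cvg]]] := homega.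
have phi_cvg := cvg_homo_infty phi_incr.
have s_cvg : y (phi i) - g (x (phi i)) @[i --> \oo] --> sbar.
  apply: cvg_comp phi_cvg (alm_shifts_cvg ipE hfcvx hgcvx hsbar hSolD halm).
have x_cvg : x (phi i) @[i --> \oo] --> xs.
  apply: (cvg_comp _ fst xy_cvg); exact: cvg_fst.
have y_cvg : y (phi i) @[i --> \oo] --> ys.
  apply: (cvg_comp _ snd xy_cvg); exact: cvg_snd.
have gx_cvg : g (x (phi i)) @[i --> \oo] --> g xs.
  apply: continuous_cvg => //.
  exact/differentiable_continuous/hgC1.1.
have ysE : ys = g xs + sbar.
  have <- := cvg_unique (@norm_hausdorff _ Y) (cvgB y_cvg gx_cvg) s_cvg.
  by rewrite subrKC.
have Kmem k : (0 < k)%N -> K (y k).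
  by case: k => // k _; have [[]] := halm.2 k.
have phi_pos : \forall i \near \oo, (0 < phi i)%N.
  exact: (phi_cvg _ (nbhs_infty_gt 0)).
have Kys : K (g xs + sbar).
  rewrite -ysE; apply: (closed_cvg _ hKcl _ _ y_cvg).
  by apply: filterS phi_pos => i; exact: Kmem.
have adj0 : euclidean_norm (adjoint ip ('d g xs) (- sbar)) = 0.
  rewrite /euclidean_norm /euclidean_dot big1 ?sqrtr0// => i _.
  rewrite adjointE linearNl /= (min_shift_stationary ipE (hgC1.1 xs) hsbar Kys).
  by rewrite oppr0 mul0r.
pose N := [set k | [/\ (0 < k)%N,
  euclidean_norm (adjoint ip ('d g (x k)) (g (x k) - y k)) <= eps &
  `|metric_proj K (g (x k)) - y k| <= eps]].
exists N; split; last first.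
  by move=> [|k] [] // _ adj prj; split => //; have [] := halm.2 k.
apply: (infinite_set_near_subseq phi_incr).
have adj_cvg : euclidean_norm (adjoint ip ('d g (x (phi i)))
    (g (x (phi i)) - y (phi i))) @[i --> \oo] --> 0.
  rewrite -adj0; apply: cvg_adjoint_norm => //.
  by under eq_cvg do rewrite -opprB; exact: cvgN.
have gap_cvg : 2 * (`|y (phi i) - g (x (phi i))| ^+ 2 - `|sbar| ^+ 2)
    @[i --> \oo] --> 0.
  rewrite -(mulr0 2) -(subrr (`|sbar| ^+ 2)).
  apply: cvgM; first exact: cvg_cst.
  apply: cvgB; last exact: cvg_cst.
  by rewrite expr2; under eq_cvg do rewrite expr2; apply: cvgM; exact: cvg_norm.
have e20 : 0 < eps ^+ 2 by rewrite exprn_gt0.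
near=> i; have i0 : (0 < phi i)%N by near: i.
split => //.
  apply: le_trans (ler_norm _) _; near: i.
  by move/cvgr_norm_le : adj_cvg => /(_ eps); rewrite normr0; exact.
rewrite -ler_sqr ?nnegrE//; last exact: ltW.
apply: le_trans (metric_proj_close ipE hKcvx hsbar (Kmem _ i0)
  (metric_projP hY hK0 hKcl _)) _.
apply: le_trans (ler_norm _) _; near: i.
by move/cvgr_norm_le : gap_cvg => /(_ (eps ^+ 2)); rewrite normr0; exact.
Unshelve. all: by end_near. Qed.
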